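(* Let $\mathcal{A}=(A,[\cdot,\cdot],\alpha)$ be a Hom-Leibniz algebra and $P$ an averaging operator on $\mathcal{A}$. Define $\{\cdot,\cdot\}:A\times A\to A$ by $\{x,y\}=[P(x),y]$ for all $x,y\in A$. Then: (i) the triple $\mathcal{A}'=(A,\{\cdot,\cdot\},\alpha)$ is a Hom-Leibniz algebra; (ii) if $\mathcal{A}$ is a Hom-Leibniz algebra, then $\mathcal{A}'$ is a Hom-Lie algebra if and only if $[P(x),y]=-[P(y),x]$ for all $x,y\in A$; (iii) if $\mathcal{A}$ is a Hom-Lie algebra and the averaging operator $P$ is surjective, that is $P(A)=A$, then $\mathcal{A}'$ is a Hom-Lie algebra.
   Context: All vector spaces are over a field $\mathbb{K}$ of characteristic zero. A Hom-algebra $(A,[\cdot,\cdot],\alpha)$ is a vector space $A$ with a bilinear product $[\cdot,\cdot]:A\times A\to A$ and a linear map $\alpha:A\to A$. It is a Hom-Leibniz algebra if $[\alpha(x),[y,z]]=[[x,y],\alpha(z)]+[\alpha(y),[x,z]]$ for all $x,y,z\in A$. It is a Hom-Lie algebra if $[x,y]=-[y,x]$ and $[\alpha(x),[y,z]]+[\alpha(y),[z,x]]+[\alpha(z),[x,y]]=0$ for all $x,y,z\in A$. An averaging operator on it is a linear map $P:A\to A$ with $\alpha\circ P=P\circ\alpha$ and $[P(x),P(y)]=P([P(x),y])=P([x,P(y)])$ for all $x,y\in A$. *)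

(* Defs.v *)
From HB Require Import structures.
From mathcomp Require Import all_boot all_order all_algebra.
From mathcomp Require Import sesquilinear.

Set Implicit Arguments.
Unset Strict Implicit.
Unset Printing Implicit Defensive.

Import GRing.Theory.
Local Open Scope ring_scope.

(* A triple (A, [.,.], alpha) is given by the lmodType [A], of arbitrary
   dimension, and bare functions [mu] for the product and [alpha] for the
   twist. The bilinearity of [mu] and the linearity of [alpha] are part of the
   predicates, so that they are to be proved wherever a triple is claimed to be
   an algebra. *)

Definition hom_algebra (K : fieldType) (A : lmodType K)
    (mu : A -> A -> A) (alpha : A -> A) : Prop :=
  bilinear_for *:%R *:%R mu /\ linear alpha.

(* alpha is not required to be multiplicative for mu. *)
Definition hom_leibniz_algebra (K : fieldType) (A : lmodType K)
    (mu : A -> A -> A) (alpha : A -> A) : Prop :=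
  hom_algebra mu alpha /\
  forall x y z : A,
    mu (alpha x) (mu y z) = mu (mu x y) (alpha z) + mu (alpha y) (mu x z).

Definition hom_lie_algebra (K : fieldType) (A : lmodType K)
    (mu : A -> A -> A) (alpha : A -> A) : Prop :=
  [/\ hom_algebra mu alpha,
      forall x y : A, mu x y = - mu y x
    & forall x y z : A,
        mu (alpha x) (mu y z) + mu (alpha y) (mu z x) + mu (alpha z) (mu x y)
        = 0].

Definition averaging_operator (K : fieldType) (A : lmodType K)
    (mu : A -> A -> A) (alpha : A -> A) (P : A -> A) : Prop :=
  [/\ linear P,
      forall x : A, alpha (P x) = P (alpha x),
      forall x y : A, mu (P x) (P y) = P (mu (P x) y)
    & forall x y : A, P (mu (P x) y) = P (mu x (P y))].

Definition averaged_product (K : fieldType) (A : lmodType K)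
    (mu : A -> A -> A) (P : A -> A) : A -> A -> A :=
  fun x y => mu (P x) y.

(* Main.v *)
Require Import Defs.
From HB Require Import structures.
From mathcomp Require Import all_boot all_order all_algebra.

Set Implicit Arguments.
Unset Strict Implicit.
Unset Printing Implicit Defensive.

Import GRing.Theory.
Local Open Scope ring_scope.

(** Write xy for [mu x y] and {x,y} = P(x)y for the averaged product.

    The Hom-Leibniz identity says that left multiplications act as twisted
    derivations. Since P commutes with alpha, the identity for {,} is that of
    mu at the points P(x), P(y), z, once P(x)P(y) is read as P(P(x)y) in its
    first summand. This is the first claim.

    For a skew-symmetric product the Hom-Leibniz identity is the Hom-Jacobi
    identity up to the signs introduced by swapping factors, so a Hom-Leibniz
    algebra is Hom-Lie as soon as its product is skew-symmetric. Applied to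
    {,}, this gives the second claim and reduces the third one to
    skew-symmetry.

    If P is surjective, writing y = P(b) turns P(x)y into P(xy); hence {,}
    is the image under P of a skew-symmetric product, and is itself
    skew-symmetric. *)

Lemma linear_oppr (K : fieldType) (A B : lmodType K) (f : A -> B) :
  linear f -> {morph f : x / - x}.
Proof. by move=> f_lin x; rewrite -!scaleN1r (scalable_linear f_lin). Qed.

(** Swapping the factors of (xy)alpha(z) and of xz in the Hom-Leibniz identity
    yields the cyclic sum; the second swap occurs inside a product, which is
    where bilinearity enters. *)
Lemma hom_lie_of_skew_hom_leibniz (K : fieldType) (A : lmodType K)
    (mu : A -> A -> A) (alpha : A -> A) :
  hom_leibniz_algebra mu alpha -> (forall x y : A, mu x y = - mu y x) ->
  hom_lie_algebra mu alpha.
Proof.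
move=> [[mu_bilin alpha_lin] leib] skew; split=> // x y z.
rewrite leib (skew _ (alpha z)) (skew x z) (linear_oppr (mu_bilin.2 _)).
by rewrite addrNK addNr.
Qed.

Lemma averaged_hom_leibniz (K : fieldType) (A : lmodType K)
    (mu : A -> A -> A) (alpha P : A -> A) :
  hom_leibniz_algebra mu alpha -> averaging_operator mu alpha P ->
  hom_leibniz_algebra (averaged_product mu P) alpha.
Proof.
move=> [[mu_bilin alpha_lin] leib] [P_lin alphaP PP _].
rewrite /averaged_product; split; first split=> //.
  split=> [z a x y | x a y z] /=; last exact: mu_bilin.2.
  by rewrite P_lin; apply: mu_bilin.1.
by move=> x y z; rewrite -!alphaP leib PP.
Qed.

(** Surjectivity supplies a b with y = P(b), and the averaging identities give
    P(x)P(b) = P(P(x)b) = P(xP(b)). *)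
Lemma averaged_product_surj (K : fieldType) (A : lmodType K)
    (mu : A -> A -> A) (alpha P : A -> A) :
  averaging_operator mu alpha P -> (forall y : A, exists x : A, P x = y) ->
  forall x y : A, averaged_product mu P x y = P (mu x y).
Proof.
move=> [_ _ PP Pmove] P_surj x y; have [b <-] := P_surj y.
by rewrite /averaged_product PP Pmove.
Qed.

Theorem proposition2p18 (K : fieldType) (charK0 : [pchar K] =i pred0)
    (A : lmodType K) (mu : A -> A -> A) (alpha : A -> A) (P : A -> A)
    (leibA : hom_leibniz_algebra mu alpha)
    (avgP : averaging_operator mu alpha P) :
  [/\ hom_leibniz_algebra (averaged_product mu P) alpha,
      hom_leibniz_algebra mu alpha ->
        (hom_lie_algebra (averaged_product mu P) alpha <->
         forall x y : A, mu (P x) y = - mu (P y) x)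
    & hom_lie_algebra mu alpha -> (forall y : A, exists x : A, P x = y) ->
        hom_lie_algebra (averaged_product mu P) alpha].
Proof.
have leibP := averaged_hom_leibniz leibA avgP.
split=> // [_ | [_ skew _] P_surj].
  by split=> [[] // | skewP]; apply: hom_lie_of_skew_hom_leibniz.
apply: hom_lie_of_skew_hom_leibniz => // x y.
rewrite !(averaged_product_surj avgP P_surj).
have [P_lin _ _ _] := avgP.
by rewrite -(linear_oppr P_lin) -skew.
Qed.
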